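(* Let $\leqslant$ be the natural linear ordering of $\mathbb{Z}$, let $\mathbb{Z}^+=\{z\in\mathbb{Z}: z>0\}$, and let $\mathcal{U}$ be a free ultrafilter on $\mathbb{Z}$ such that $\mathbb{Z}^+\in\mathcal{U}$. Then the following statements hold: (i) $D(\mathcal{U})\subseteq(-\mathcal{U})+\mathcal{U}$; (ii) $\mathcal{U}$ is $\mathbb{Z}$-Ramsey if and only if $D(\mathcal{U})=(-\mathcal{U})+\mathcal{U}$.
   Context: An ultrafilter is free if it is non-principal. $[\mathbb{Z}]^2$ denotes the set of $2$-element subsets of $\mathbb{Z}$, and $\mathbb{Z}$ acts on itself by translations. A free ultrafilter $\mathcal{U}$ on $\mathbb{Z}$ is $\mathbb{Z}$-Ramsey if, for every coloring $\chi:[\mathbb{Z}]^2\to\{0,1\}$ satisfying $\chi(\{g+x,g+y\})=\chi(\{x,y\})$ for all $\{x,y\}\in[\mathbb{Z}]^2$ and $g\in\mathbb{Z}$, there exists $U\in\mathcal{U}$ such that $\chi$ is constant on $[U]^2$. For $U\subseteq\mathbb{Z}$, $D(U)=\{y-x: x,y\in U,\ x<y\}$. For an ultrafilter $\mathcal{U}$ on $\mathbb{Z}$, $D(\mathcal{U})$ is the family of subsets of $\mathbb{Z}$ defined by: $V\in D(\mathcal{U})$ if and only if there exists $U\in\mathcal{U}$ with $D(U)\subseteq V$. $-\mathcal{U}=\{-U: U\in\mathcal{U}\}$, where $-U=\{-u:u\in U\}$. For ultrafilters $\mathcal{V},\mathcal{U}$ on $\mathbb{Z}$, the sum $\mathcal{V}+\mathcal{U}$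 is the ultrafilter on $\mathbb{Z}$ with base consisting of all sets $\bigcup_{g\in V}(g+U_g)$, where $V\in\mathcal{V}$ and $U_g\in\mathcal{U}$ for each $g\in V$; equivalently, $A\in\mathcal{V}+\mathcal{U}$ if and only if $\{g\in\mathbb{Z}: -g+A\in\mathcal{U}\}\in\mathcal{V}$. *)

(* Defs.v *)
From HB Require Import structures.
From mathcomp Require Import all_boot all_order all_algebra.
From mathcomp Require Import all_classical.

Set Implicit Arguments.
Unset Strict Implicit.
Unset Printing Implicit Defensive.

Import Order.TTheory GRing.Theory Num.Theory.

Local Open Scope classical_set_scope.
Local Open Scope ring_scope.
Local Open Scope card_scope.

Definition free_ultrafilter (T : Type) (U : set_system T) : Prop :=
  UltraFilter U /\ forall x : T, U <> principal_filter x.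

Definition doubletons (T : Type) (A : set T) : set (set T) :=
  [set e | e `<=` A /\ e #= `I_2].

Definition translate (g : int) (A : set int) : set int := +%R g @` A.

(* A coloring of [Z]^2 is represented by a total function on [set int], of which
   only the values on [doubletons setT] are ever used. *)
Definition translation_invariant (chi : set int -> bool) : Prop :=
  forall (g : int) (e : set int),
    doubletons setT e -> chi (translate g e) = chi e.

Definition monochromatic (chi : set int -> bool) (A : set int) : Prop :=
  exists c : bool, forall e : set int, doubletons A e -> chi e = c.

Definition Z_Ramsey (U : set_system int) : Prop :=
  free_ultrafilter U /\
  forall chi : set int -> bool, translation_invariant chi ->
    exists2 A : set int, U A & monochromatic chi A.

Definition differences (A : set int) : set int :=
  [set d | exists x y : int, [/\ A x, A y, x < y & d = y - x]].

Definition difference_family (U : set_system int) : set_system int :=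
  filter_from U differences.

Definition opp_system (U : set_system int) : set_system int :=
  [set -%R @` A | A in U].

(* The family with base the sets \bigcup_(g in A) (g + B g), for A in V and
   B g in U for all g in A; the index is the pair p = (A, B). *)
Definition add_system (V U : set_system int) : set_system int :=
  filter_from
    [set p : set int * (int -> set int) |
      V p.1 /\ forall g : int, p.1 g -> U (p.2 g)]
    (fun p => \bigcup_(g in p.1) translate g (p.2 g)).

Lemma doubletonsP (T : Type) (A e : set T) :
  doubletons A e <->
  exists x y : T, [/\ A x, A y, x <> y & e = [set x; y]].
Proof.
split=> [[eA]|[x [y [Ax Ay xy ->]]]].
  move=> /eq_cardSP[x ex] /eq_cardSP[y [ey yx]].
  rewrite II0 card_eq0 => /eqP e0; exists x, y.
  split; [exact: eA|exact: eA|by move=> xy; apply: yx|].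
  apply/seteqP; split=> z; last by case=> ->.
  move=> ez; apply: contrapT => /= /not_orP[zx zy].
  by have : (e `\ x `\ y) z by []; rewrite e0.
split=> [z [->|->]//|].
apply/eq_cardSP; exists x; first by left.
apply/eq_cardSP; exists y; first by split; [right|exact/nesym].
by rewrite II0 card_eq0; apply/eqP/seteqP; split=> [z [[[]]]|z []].
Qed.

Lemma add_systemE (V U : set_system int) (FV : Filter V) (FU : Filter U) :
  add_system V U = [set A | V [set g | U (translate (- g) A)]].
Proof.
apply/seteqP; split=> A /=.
  move=> [[W B] /= [VW UB] WBA]; apply: filterS VW => g Wg /=.
  apply: filterS (UB _ Wg) => u Bu; exists (g + u); last by rewrite addKr.
  by apply: WBA; exists g => //; exists u.
move=> VA; exists ([set g | U (translate (- g) A)], fun g => translate (- g) A).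
  by split.
by move=> _ /= [g _ [_ [a Aa <-] <-]]; rewrite addNKr.
Qed.

Lemma opp_systemE (U : set_system int) :
  opp_system U = [set A | U (-%R @` A)].
Proof.
have oppK A : -%R @` (-%R @` A) = A :> set int.
  by rewrite image_comp (eq_imagel (f' := id)) ?image_id // => x _ /=; rewrite opprK.
apply/seteqP; split=> A /=.
  by move=> [B UB <-]; rewrite oppK.
by move=> UA; exists (-%R @` A).
Qed.

(* Main.v *)
(** A set A lies in (-U) + U exactly when y - x is in A for U-almost all x and,
    given x, for U-almost all y; since U contains every tail of Z, such y may be
    taken above x, which gives (i). A translation-invariant coloring chi is
    determined by the set of d > 0 with chi {0, d} = 1, and a set monochromatic
    for chi is one whose differences all lie in that set or all in its
    complement. As (-U) + U is an ultrafilter containing D(U), the two families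
    coincide exactly when D(U) decides every set of differences. *)

Require Import Defs.
From mathcomp Require Import all_boot all_order all_algebra.
From mathcomp Require Import all_classical.
From mathcomp Require Import zify.

Import Order.TTheory GRing.Theory Num.Theory.

Local Open Scope classical_set_scope.
Local Open Scope ring_scope.

(** Otherwise [[set x]] would belong to [U], and the members of [U] would be exactly the sets
    through [x]. *)
Lemma free_ultrafilterC1 (T : Type) (U : set_system T) (x : T) :
  free_ultrafilter U -> U (~` [set x]).
Proof.
move=> [UU nprinc]; case: (in_ultra_setVsetC [set x] UU) => // Ux.
exfalso; apply: (nprinc x); apply/seteqP; split=> A.
  move=> UA; apply/principal_filterP.
  by have [_ [-> ]] := filter_ex (filterI Ux UA).
by move=> /principal_filterP Ax; apply: filterS Ux => _ ->.
Qed.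

Lemma free_ultrafilter_gt (U : set_system int) (x : int) :
  free_ultrafilter U -> U [set z : int | 0 < z] -> U [set z : int | x < z].
Proof.
move=> freeU U0; have [UU _] := freeU.
suff Un (n : nat) : U [set z : int | n%:Z < z].
  by apply: filterS (Un `|x|%N) => z /=; lia.
(* By integrality, removing the single point [n.+1] from the tail above [n] leaves the tail above
   [n.+1]. *)
elim: n => [//|n IHn].
apply: filterS (filterI IHn (free_ultrafilterC1 _ _ n.+1%:Z freeU)) => z /= [nz].
by move=> /eqP; lia.
Qed.

Lemma opp_system_filter (U : set_system int) : Filter U -> Filter (opp_system U).
Proof.
(* Negation is an involution, so images are preimages, which respect intersections and
   inclusions. *)
have imN (A : set int) : -%R @` A = -%R @^-1` A.
  apply/seteqP; split=> [_ [z Az <-]|z Az] /=; first by rewrite opprK.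
  by exists (- z); rewrite ?opprK.
move=> FU; rewrite opp_systemE; split=> [|A B|A B AB]; rewrite /mkset !imN.
- exact: filterT.
- exact: filterI.
- by apply: filterS => z; apply: AB.
Qed.

(** The two signs cancel: for [g = - x], the translate of [A] by [- g] is the set of [y] with
    [y - x] in [A]. *)
Lemma add_oppE (U : set_system int) : Filter U ->
  add_system (opp_system U) U =
  [set A | \forall x \near U, \forall y \near U, A (y - x)].
Proof.
move=> FU; have FoU := @opp_system_filter U FU.
have trE (x : int) (A : set int) : translate x A = [set y | A (y - x)].
  apply/seteqP; split=> [_ [y Ay <-]|y Ay] /=; first by rewrite addrC addKr.
  by exists (y - x) => //; rewrite addrC subrK.
rewrite add_systemE opp_systemE; apply/seteqP.
split=> A /=; apply: filterS => x.
  by move=> [g /= UA <-]; rewrite trE in UA.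
by move=> UA; exists (- x); rewrite /= ?opprK ?trE.
Qed.

Lemma difference_family_sub (U : set_system int) :
  free_ultrafilter U -> U [set z : int | 0 < z] ->
  difference_family U `<=` add_system (opp_system U) U.
Proof.
move=> freeU U0 A [B UB BA]; have [UU _] := freeU.
rewrite add_oppE /=; apply: filterS (UB) => x Bx.
apply: filterS (filterI UB (free_ultrafilter_gt U x freeU U0)) => y [By xy].
by apply: BA; exists x, y.
Qed.

Lemma add_opp_ultra (U : set_system int) (A : set int) : UltraFilter U ->
  add_system (opp_system U) U A \/ add_system (opp_system U) U (~` A).
Proof.
move=> UU; rewrite add_oppE /=.
(* The ultrafilter dichotomy is used twice, first for [x], then for [y] at fixed [x]. *)
case: (in_ultra_setVsetC [set x | \forall y \near U, A (y - x)] UU).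
  by left.
move=> UnA; right; apply: filterS UnA => x /= nUA.
by case: (in_ultra_setVsetC [set y | A (y - x)] UU).
Qed.

Lemma add_opp_disjoint (U : set_system int) (A : set int) : ProperFilter U ->
  add_system (opp_system U) U A -> ~ add_system (opp_system U) U (~` A).
Proof.
move=> PU; rewrite add_oppE /= => UA UnA.
have [x [UAx UnAx]] := filter_ex (filterI UA UnA).
by have [y []] := filter_ex (filterI UAx UnAx).
Qed.

(** The condition [x < y] orients the unordered pair, so the colour tests its positive
    difference. *)
Definition difference_coloring (A e : set int) : bool :=
  `[< exists x y : int, [/\ e x, e y, x < y & A (y - x)] >].

Lemma difference_coloring_invariant (A : set int) :
  translation_invariant (difference_coloring A).
Proof.
move=> g e _; apply/asboolP/asboolP => -[x [y []]].
  move=> [x' ex' <-] [y' ey' <-] xy; rewrite opprD addrACA subrr add0r => Axy.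
  by exists x', y'; split=> //; lia.
move=> ex ey xy Axy; exists (g + x), (g + y).
split; [by exists x|by exists y|by rewrite ltrD2l|].
by rewrite opprD addrACA subrr add0r.
Qed.

Lemma difference_coloring_pair (A : set int) (x y : int) : x < y ->
  difference_coloring A [set x; y] = `[< A (y - x) >].
Proof.
move=> xy; apply/asboolP/asboolP => [[u [v [+ + uv]]]|Axy].
  by move=> [uE|uE] [vE|vE]; rewrite uE vE // in uv *; lia.
by exists x, y; split=> //; [left|right].
Qed.

Lemma coloring_pairE (chi : set int -> bool) (x y : int) :
  translation_invariant chi -> x < y -> chi [set x; y] = chi [set 0; y - x].
Proof.
move=> inv xy; rewrite -(inv x [set 0; y - x]).
  by rewrite /translate image_setU !image_set1 addr0 addrC subrK.
by apply/doubletonsP; exists 0, (y - x); split=> //; lia.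
Qed.

Lemma monochromatic_differences (chi : set int -> bool) (B : set int) (c : bool) :
  translation_invariant chi ->
  differences B `<=` [set d | chi [set 0; d] = c] -> monochromatic chi B.
Proof.
move=> inv DB; exists c => e /doubletonsP[x [y [Bx By /eqP xy ->]]].
wlog lexy : x y Bx By xy / x < y.
  move=> wlt; have [lxy|lyx] : x < y \/ y < x by lia.
    exact: wlt.
  by rewrite setUC; apply: wlt => //; rewrite eq_sym.
by rewrite coloring_pairE //; apply: DB; exists x, y.
Qed.

Theorem theorem5 (U : set_system int) (freeU : free_ultrafilter U)
    (posU : U [set z : int | 0 < z]) :
  difference_family U `<=` add_system (opp_system U) U /\
  (Z_Ramsey U <-> difference_family U = add_system (opp_system U) U).
Proof.
have DUsub := @difference_family_sub U freeU posU; have [UU _] := freeU.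
split=> //; split=> [[_ ramsey]|DUE].
  apply/seteqP; split=> // A WA.
  (* A monochromatic [B] has all its differences in [A] or all outside [A]; the latter would put the
     complement of [A] in the sum by (i), contradicting [WA]. *)
  have [B UB [c Bc]] := ramsey _ (difference_coloring_invariant A).
  have DB d : differences B d -> `[< A d >] = c.
    move=> [x [y [Bx By xy ->]]]; rewrite -difference_coloring_pair //.
    apply: Bc; apply/doubletonsP; exists x, y; split=> //.
    by move=> xyE; rewrite xyE ltxx in xy.
  case: c {Bc} DB => DB; first by exists B => // d /DB /asboolP.
  case: (@add_opp_disjoint U A _ WA); apply: DUsub.
  by exists B => // d /DB /asboolPn.
split=> // chi inv.
(* The sum decides the set of differences coloured [true]; by [DUE] this decision is witnessed by
   the differences of some [B] in [U]. *)
case: (add_opp_ultra U [set d | chi [set 0; d]] UU); rewrite -DUE => -[B UB DB].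
  by exists B => //; apply: (monochromatic_differences chi B true inv).
exists B => //; apply: (monochromatic_differences chi B false inv) => d /DB /negP.
exact: negbTE.
Qed.
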